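(* Let $s>0$. There exists $n_0(s)\in\mathbb{N}^+$ such that for every positive integer $n>2s$ the following holds for the equation $$p\,\frac{\Gamma\left(\frac{n}{2}-\frac{s}{p-1}\right)\Gamma\left(s+\frac{s}{p-1}\right)}{\Gamma\left(\frac{s}{p-1}\right)\Gamma\left(\frac{n-2s}{2}-\frac{s}{p-1}\right)}=\frac{\Gamma\left(\frac{n+2s}{4}\right)^2}{\Gamma\left(\frac{n-2s}{4}\right)^2}\qquad (E)$$ in the unknown real number $p>\frac{n}{n-2s}$. (1) If $n\le n_0(s)$, then (E) has exactly one real root $p$, and $$p=\frac{n+2s-2+2a_{n,s}\sqrt{n}}{n-2s-2+2a_{n,s}\sqrt{n}},$$ where $a_{n,s}$ satisfies $\frac{1}{\sqrt n}<a_{n,s}<\frac12\frac{n-2s}{\sqrt n}+\frac{1}{\sqrt n}$ and is the unique positive root of the function $f_{n,s}$ (defined in the context). (2) If $n>n_0(s)$, then (E) has exactly two real roots $p_1$ and $p_2$, where $$p_1=\frac{n+2s-2+2a_{n,s}\sqrt{n}}{n-2s-2+2a_{n,s}\sqrt{n}},\qquad p_2=\frac{n+2s-2-2a_{n,s}\sqrt{n}}{n-2s-2-2a_{n,s}\sqrt{n}}$$ (with $a_{n,s}$ the same unique positive root of $f_{n,s}$). Moreover, $$\frac{n}{n-2s}<p_1<\frac{n+2s}{n-2s}<p_2<+\infty.$$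
   Context: $\Gamma$ is the Gamma function. For a positive integer $n$ and real $s$ with $0<s<n/2$, the function $f_{n,s}$ is defined for real $a$ with $-\frac12\frac{n-2s}{\sqrt n}-\frac1{\sqrt n}<a<\frac12\frac{n-2s}{\sqrt n}+\frac1{\sqrt n}$ (so that all Gamma arguments are positive) by $$f_{n,s}(a)=\ln\Gamma\left(\tfrac n4+\tfrac s2+\tfrac12+\tfrac12a\sqrt n\right)+\ln\Gamma\left(\tfrac n4+\tfrac s2+\tfrac12-\tfrac12a\sqrt n\right)-2\ln\Gamma\left(\tfrac n4+\tfrac s2\right)$$ $$\qquad-\ln\Gamma\left(\tfrac n4-\tfrac s2+\tfrac12+\tfrac12a\sqrt n\right)-\ln\Gamma\left(\tfrac n4-\tfrac s2+\tfrac12-\tfrac12a\sqrt n\right)+2\ln\Gamma\left(\tfrac n4-\tfrac s2\right).$$ *)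

(* Defs.v *)
From Stdlib Require Import Reals.
From Coquelicot Require Import Coquelicot.
Open Scope R_scope.

(* Only meaningful for 0 < z, where the integral converges. *)
Definition Gamma (z : R) : R :=
  RInt_gen (fun t => Rpower t (z - 1) * exp (- t))
           (at_right 0) (Rbar_locally p_infty).

Definition lnGamma (z : R) : R := ln (Gamma z).

Definition f_dom (n : nat) (s a : R) : Prop :=
  - (1 / 2 * ((INR n - 2 * s) / sqrt (INR n))) - 1 / sqrt (INR n) < a
  /\ a < 1 / 2 * ((INR n - 2 * s) / sqrt (INR n)) + 1 / sqrt (INR n).

Definition f (n : nat) (s a : R) : R :=
    lnGamma (INR n / 4 + s / 2 + 1 / 2 + 1 / 2 * a * sqrt (INR n))
  + lnGamma (INR n / 4 + s / 2 + 1 / 2 - 1 / 2 * a * sqrt (INR n))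
  - 2 * lnGamma (INR n / 4 + s / 2)
  - lnGamma (INR n / 4 - s / 2 + 1 / 2 + 1 / 2 * a * sqrt (INR n))
  - lnGamma (INR n / 4 - s / 2 + 1 / 2 - 1 / 2 * a * sqrt (INR n))
  + 2 * lnGamma (INR n / 4 - s / 2).

Definition positive_root_f (n : nat) (s a : R) : Prop :=
  f_dom n s a /\ 0 < a /\ f n s a = 0.

Definition eqE (n : nat) (s p : R) : Prop :=
  p * (Gamma (INR n / 2 - s / (p - 1)) * Gamma (s + s / (p - 1))
       / (Gamma (s / (p - 1)) * Gamma ((INR n - 2 * s) / 2 - s / (p - 1))))
  = Gamma ((INR n + 2 * s) / 4) ^ 2 / Gamma ((INR n - 2 * s) / 4) ^ 2.

(* The constraint on p is part of being a root: it makes every argument of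
   Gamma in eqE positive. *)
Definition rootE (n : nat) (s p : R) : Prop :=
  INR n / (INR n - 2 * s) < p /\ eqE n s p.

Definition den1 (n : nat) (s a : R) : R :=
  INR n - 2 * s - 2 + 2 * a * sqrt (INR n).

Definition den2 (n : nat) (s a : R) : R :=
  INR n - 2 * s - 2 - 2 * a * sqrt (INR n).

Definition p1 (n : nat) (s a : R) : R :=
  (INR n + 2 * s - 2 + 2 * a * sqrt (INR n)) / den1 n s a.

Definition p2 (n : nat) (s a : R) : R :=
  (INR n + 2 * s - 2 - 2 * a * sqrt (INR n)) / den2 n s a.

(* Main.v *)
Require Import Defs.
From Stdlib Require Import Reals Lra Lia.
From Coquelicot Require Import Coquelicot.
Open Scope R_scope.

(** Put [c = n/4 - s/2] and [D(x) = lnGamma (x + s) - lnGamma x], and parametrize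
    [p > n/(n-2s)] by [x = s/(p-1)], that is [p = (x+s)/x] with [0 < x < 2c].
    Since [p * Gamma (s+x) / Gamma x = Gamma (x+s+1) / Gamma (x+1)], the logarithm of
    equation (E) reads [D (c + 1/2 + u) + D (c + 1/2 - u) = 2 D c] with
    [u = x - (c - 1/2)] ([eqE_iff_sym_incr]), and the same expression with
    [u = a * sqrt n / 2] is [f n s a] ([f_eq_sym_incr]).  The left side is even in [u],
    so everything depends on how it varies for [u >= 0].

    It decreases strictly from a value above [2 D c] at [u = 1/2] (where the
    functional equation makes the excess [ln ((c+s)/c)]) to minus infinity at
    [u = c + 1/2]; hence it takes the value [2 D c] at exactly two points [u0] and
    [-u0], and [1/2 < u0 < c + 1/2] ([sym_incr_unique_level]).  The point [u0] always
    gives an admissible [x], whereas [-u0] gives [x = c - 1/2 - u0], which is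
    positive exactly when [c > 1/2] and the left side at [u = c - 1/2] is already
    below [2 D c], that is, when [endpoint_gap s c = D (2c) + D 1 - 2 D c] is
    negative.  This gap decreases in [c] and tends to minus infinity, so the second
    root is present exactly beyond a threshold in [n].  Comparing [u0] and [-u0] with
    [u = 1/2], which corresponds to [p = (n+2s)/(n-2s)], orders the roots.

    Both monotonicity statements are obtained without the digamma function.  Under
    [x -> x + 1] the function [D] changes by [ln ((x+s)/x)], so along integer shifts
    the difference to be estimated changes monotonically, by explicit logarithms; and
    it tends to 0 because log-convexity squeezes [D x], for [x > 1], between
    [s * ln (x-1)] and [s * ln (x+s)] ([lnGamma_incr_shift]).  A
    nondecreasing sequence with limit 0 is nonpositive.  This is the Bohr-Mollerup mechanism: all that is used about Gamma
    is positivity, [Gamma (z+1) = z * Gamma z] and log-convexity, which are first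
    derived from the integral. *)

(** * Improper integrals and convergence of the Gamma integral *)

Lemma RInt_le_widen (g : R -> R) (a a0 b0 b : R) :
  (forall t, 0 < t -> continuous g t) -> (forall t, 0 < t -> 0 <= g t) ->
  0 < a -> a <= a0 -> a0 <= b0 -> b0 <= b -> RInt g a0 b0 <= RInt g a b.
Proof.
  intros Hc Hpos Ha H1 H2 H3.
  assert (Hex : forall u v, 0 < u -> u <= v -> ex_RInt g u v).
  { intros u v Hu Huv. apply (@ex_RInt_continuous R_CompleteNormedModule); intros t Ht.
    rewrite Rmin_left in Ht by lra. apply Hc; lra. }
  assert (Hge : forall u v, 0 < u -> u <= v -> 0 <= RInt g u v).
  { intros u v Hu Huv. apply RInt_ge_0; auto. intros t Ht; apply Hpos; lra. }
  rewrite <- (RInt_Chasles g a a0 b) by (apply Hex; lra).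
  rewrite <- (RInt_Chasles g a0 b0 b) by (apply Hex; lra).
  change plus with Rplus.
  assert (0 <= RInt g a a0) by (apply Hge; lra).
  assert (0 <= RInt g b0 b) by (apply Hge; lra).
  lra.
Qed.

(** The integrals over compact intervals increase with the interval, so their
    supremum is their limit along the product filter. *)
Lemma ex_RInt_gen_nonneg_bounded (g : R -> R) (M : R) :
  (forall t, 0 < t -> continuous g t) -> (forall t, 0 < t -> 0 <= g t) ->
  (forall a b, 0 < a -> a <= b -> RInt g a b <= M) ->
  ex_RInt_gen g (at_right 0) (Rbar_locally p_infty).
Proof.
  intros Hc Hpos HM.
  destruct (completeness (fun v => exists a b, 0 < a /\ a <= b /\ v = RInt g a b))
    as [S [Hub Hlub]].
  { exists M. intros v (a & b & Ha & Hab & ->). auto. }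
  { exists (RInt g 1 1), 1, 1. lra. }
  exists S. apply filterlimi_locally. intros eps.
  assert (Hnear : exists a0 b0, 0 < a0 /\ a0 <= b0 /\ S - eps < RInt g a0 b0).
  { destruct (Classical_Prop.classic
      (exists a0 b0, 0 < a0 /\ a0 <= b0 /\ S - eps < RInt g a0 b0)) as [|Hn]; auto.
    assert (S <= S - eps).
    { apply Hlub. intros v (a & b & Ha & Hab & ->).
      apply Rnot_lt_le. intros H. apply Hn. exists a, b; auto. }
    pose proof (cond_pos eps); lra. }
  destruct Hnear as (a0 & b0 & Ha0 & Hab0 & Hlt).
  apply (Filter_prod _ _ _ (fun a => 0 < a /\ a < a0) (fun b => b0 < b)).
  - exists (mkposreal a0 Ha0). intros y Hy Hy0.
    apply Rabs_def2 in Hy. unfold minus, plus, opp in Hy; simpl in Hy. lra.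
  - exists b0; auto.
  - intros a b [Ha Haa] Hb. simpl.
    exists (RInt g a b). split.
    + apply (RInt_correct g), (@ex_RInt_continuous R_CompleteNormedModule). intros t Ht.
      rewrite Rmin_left in Ht by lra. apply Hc; lra.
    + assert (RInt g a0 b0 <= RInt g a b) by (apply RInt_le_widen; auto; lra).
      assert (RInt g a b <= S) by (apply Hub; exists a, b; lra).
      pose proof (cond_pos eps).
      apply Rabs_def1; unfold minus, plus, opp; simpl; lra.
Qed.

Definition gamma_density (z t : R) : R := Rpower t (z - 1) * exp (- t).

Lemma gamma_density_pos (z t : R) : 0 < gamma_density z t.
Proof. apply Rmult_lt_0_compat; apply exp_pos. Qed.

Lemma gamma_density_continuous (z t : R) : 0 < t -> continuous (gamma_density z) t.
Proof.
  intros Ht. apply (ex_derive_continuous (gamma_density z)).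
  unfold gamma_density, Rpower. auto_derive. lra.
Qed.

Lemma ln_le_sub1 (y : R) : 0 < y -> ln y <= y - 1.
Proof.
  intros Hy. pose proof (exp_ineq1_le (ln y)). rewrite exp_ln in H by lra. lra.
Qed.

(** The maximum of the left side in [t] is [w^w * exp (-w)], attained at [t = w]; the
    factor [exp (-w)] is dropped. *)
Lemma Rpower_exp_bound (w t : R) :
  0 < w -> 0 < t -> Rpower t w * exp (- t) <= Rpower w w.
Proof.
  intros Hw Ht. unfold Rpower. rewrite <- exp_plus.
  assert (H : ln t - ln w <= t / w - 1).
  { rewrite <- ln_div by lra. apply ln_le_sub1. apply Rdiv_lt_0_compat; lra. }
  assert (w * (ln t - ln w) <= t - w).
  { replace (t - w) with (w * (t / w - 1)) by (field; lra).
    apply Rmult_le_compat_l; lra. }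
  destruct (Rle_lt_or_eq_dec (w * ln t + - t) (w * ln w)) as [Hl|He]; [lra| |].
  - apply Rlt_le, exp_increasing; auto.
  - rewrite He; lra.
Qed.

(** Splitting the integral at 1 is avoided by one comparison function: the density is
    dominated by the derivative of [- C / (1 + t^z)], whose total variation is [C].
    Near 0 that derivative is of order [t^(z-1)], and near infinity the inequality
    reduces to [(1 + t^z)^2 = O (exp t)]. *)
Lemma gamma_density_partial_bound (z a b : R) :
  0 < z -> 0 < a -> a <= b ->
  RInt (gamma_density z) a b <= 2 * (1 + Rpower (2 * z) (2 * z)) / z.
Proof.
  intros Hz Ha Hab.
  set (K := 1 + Rpower (2 * z) (2 * z)).
  assert (HK : 1 < K) by (unfold K, Rpower; pose proof (exp_pos (2 * z * ln (2 * z))); lra).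
  set (C := 2 * K / z).
  assert (HC : 0 < C) by (apply Rdiv_lt_0_compat; lra).
  set (H := fun t => - C / (1 + Rpower t z)).
  set (h := fun t => C * z * Rpower t (z - 1) / (1 + Rpower t z) ^ 2).
  assert (HI : is_RInt h a b (minus (H b) (H a))).
  { apply (is_RInt_derive H h).
    - intros t Ht. rewrite Rmin_left, Rmax_right in Ht by lra.
      unfold H, h. replace (Rpower t (z - 1)) with (Rpower t z / t).
      2:{ unfold Rminus. rewrite Rpower_plus, Rpower_Ropp, Rpower_1 by lra. reflexivity. }
      unfold Rpower. auto_derive.
      + split; [lra|]. pose proof (exp_pos (z * ln t)). split; [lra|auto].
      + pose proof (exp_pos (z * ln t)). field. lra.
    - intros t Ht. rewrite Rmin_left, Rmax_right in Ht by lra.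
      apply (ex_derive_continuous h). unfold h, Rpower. auto_derive.
      pose proof (exp_pos (z * ln t)). repeat split; try lra.
      apply Rgt_not_eq. repeat apply Rmult_lt_0_compat; lra. }
  assert (Hle : RInt (gamma_density z) a b <= RInt h a b).
  { apply RInt_le; auto.
    - apply (@ex_RInt_continuous R_CompleteNormedModule); intros t Ht.
      rewrite Rmin_left in Ht by lra. apply gamma_density_continuous; lra.
    - eexists; eauto.
    - intros t Ht. unfold gamma_density, h.
      pose proof (Rpower_exp_bound (2 * z) t ltac:(lra) ltac:(lra)) as HB.
      replace (2 * z) with (z + z) in HB at 1 by ring. rewrite Rpower_plus in HB.
      set (P := Rpower t z) in *.
      assert (HP : 0 < P) by apply exp_pos.
      assert (Hq : 0 < Rpower t (z - 1)) by apply exp_pos.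
      assert (He : exp (- t) < 1).
      { rewrite <- exp_0. apply exp_increasing. lra. }
      assert (He0 : 0 < exp (- t)) by apply exp_pos.
      assert (Hm : (1 + P) ^ 2 * exp (- t) <= 2 * K).
      { apply Rle_trans with (2 * (1 + P * P) * exp (- t)).
        - apply Rmult_le_compat_r; [lra|]. pose proof (pow2_ge_0 (1 - P)). nra.
        - unfold K. nra. }
      apply Rmult_le_reg_r with ((1 + P) ^ 2).
      { apply pow_lt; lra. }
      replace (C * z * Rpower t (z - 1) / (1 + P) ^ 2 * (1 + P) ^ 2)
        with (Rpower t (z - 1) * (2 * K)) by (unfold C; field; lra).
      replace (Rpower t (z - 1) * exp (- t) * (1 + P) ^ 2)
        with (Rpower t (z - 1) * ((1 + P) ^ 2 * exp (- t))) by ring.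
      apply Rmult_le_compat_l; lra. }
  rewrite (is_RInt_unique _ _ _ _ HI) in Hle.
  eapply Rle_trans; [apply Hle|].
  unfold minus, plus, opp, H; simpl. fold K C.
  assert (Ha1 : 0 < Rpower a z) by apply exp_pos.
  assert (Hb1 : 0 < Rpower b z) by apply exp_pos.
  assert (0 < C / (1 + Rpower b z)) by (apply Rdiv_lt_0_compat; lra).
  assert (C / (1 + Rpower a z) <= C).
  { apply Rmult_le_reg_r with (1 + Rpower a z); [lra|].
    unfold Rdiv. rewrite Rmult_assoc, Rinv_l by lra. nra. }
  unfold Rdiv in *. rewrite !Ropp_mult_distr_l_reverse. unfold C, Rdiv in *. lra.
Qed.

Lemma is_RInt_gen_Gamma (z : R) :
  0 < z -> is_RInt_gen (gamma_density z) (at_right 0) (Rbar_locally p_infty) (Gamma z).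
Proof.
  intros Hz. apply (RInt_gen_correct (gamma_density z)).
  apply ex_RInt_gen_nonneg_bounded with (2 * (1 + Rpower (2 * z) (2 * z)) / z).
  - intros; apply gamma_density_continuous; auto.
  - intros; apply Rlt_le, gamma_density_pos.
  - intros; apply gamma_density_partial_bound; auto.
Qed.

(** * Positivity, functional equation and log-convexity of Gamma *)

(** Bounds on the endpoints that hold eventually and keep the integration interval
    inside the positive half-line, where the density is smooth. *)
Lemma filter_prod_pos_lt :
  filter_prod (at_right 0) (Rbar_locally p_infty)
    (fun ab : R * R => 0 < fst ab /\ fst ab < 1 /\ 2 < snd ab).
Proof.
  apply (Filter_prod _ _ _ (fun a => 0 < a /\ a < 1) (fun b => 2 < b)).
  - exists (mkposreal 1 Rlt_0_1). intros y Hy Hy0.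
    apply Rabs_def2 in Hy. unfold minus, plus, opp in Hy; simpl in Hy. lra.
  - exists 2; auto.
  - intros a b ? ?; simpl; tauto.
Qed.

(** The partial integral over [[1, 2]] is a positive lower bound. *)
Lemma Gamma_pos (z : R) : 0 < z -> 0 < Gamma z.
Proof.
  intros Hz.
  set (m := RInt (gamma_density z) 1 2).
  assert (Hm : 0 < m).
  { apply RInt_gt_0; [lra| |].
    - intros; apply gamma_density_pos.
    - intros; apply gamma_density_continuous; lra. }
  apply Rlt_le_trans with m; [auto|].
  apply Rnot_lt_le. intros Hlt.
  pose proof (is_RInt_gen_Gamma z Hz) as HG.
  assert (He : 0 < m - Gamma z) by lra.
  pose proof (proj1 (filterlimi_locally _ _) HG (mkposreal _ He)) as HF.
  destruct (filter_ex _ (filter_and _ _ HF filter_prod_pos_lt))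
    as [[a b] [(I & HI & Hball) (H1 & H2 & H3)]]; simpl in *.
  apply (@is_RInt_unique R_CompleteNormedModule) in HI.
  apply Rabs_def2 in Hball. unfold minus, plus, opp in Hball; simpl in Hball.
  assert (m <= I).
  { rewrite <- HI. apply RInt_le_widen; try lra.
    - intros; apply gamma_density_continuous; auto.
    - intros; apply Rlt_le, gamma_density_pos. }
  lra.
Qed.

Lemma Rpower_exp_at_0 (z : R) :
  0 < z -> filterlim (fun t => Rpower t z * exp (- t)) (at_right 0) (locally 0).
Proof.
  intros Hz. apply filterlim_locally. intros eps.
  set (d := Rpower eps (/ z)). assert (Hd : 0 < d) by apply exp_pos.
  (* With this [d], [t < d] means [t^z < eps]. *)
  exists (mkposreal d Hd). intros t Ht Ht0.
  apply Rabs_def2 in Ht. unfold minus, plus, opp in Ht; simpl in Ht.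
  assert (Rpower t z < eps).
  { replace (pos eps) with (Rpower d z).
    - apply Rlt_Rpower_l; lra.
    - unfold d. rewrite Rpower_mult, Rinv_l, Rpower_1; try lra. apply cond_pos. }
  assert (0 < Rpower t z) by apply exp_pos.
  assert (0 < exp (- t)) by apply exp_pos.
  assert (exp (- t) < 1) by (rewrite <- exp_0; apply exp_increasing; lra).
  apply Rabs_def1; unfold minus, plus, opp; simpl; nra.
Qed.

Lemma Rpower_exp_at_infty (z : R) :
  0 < z -> filterlim (fun t => Rpower t z * exp (- t)) (Rbar_locally p_infty) (locally 0).
Proof.
  intros Hz. apply filterlim_locally. intros eps.
  pose proof (cond_pos eps) as Heps.
  (* Bounding [t^(z+1) * exp (-t)] by [K] gives the decay [K / t]. *)
  set (K := Rpower (z + 1) (z + 1)). assert (HK : 0 < K) by apply exp_pos.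
  exists (K / eps). intros t Ht.
  assert (Hq : 0 < K / eps) by (apply Rdiv_lt_0_compat; auto).
  assert (Ht0 : 0 < t) by lra.
  pose proof (Rpower_exp_bound (z + 1) t ltac:(lra) Ht0) as HB. fold K in HB.
  rewrite Rpower_plus, Rpower_1 in HB by auto.
  assert (0 < Rpower t z * exp (- t)) by (apply Rmult_lt_0_compat; apply exp_pos).
  assert (K < t * eps).
  { apply Rmult_lt_reg_r with (/ eps); [apply Rinv_0_lt_compat; auto|].
    rewrite Rmult_assoc, Rinv_r by lra. unfold Rdiv in Ht. lra. }
  apply Rabs_def1; unfold minus, plus, opp; simpl; [|lra].
  apply Rmult_lt_reg_r with t; [auto|]. lra.
Qed.

(** The function [t^z * exp (-t)] vanishes at both ends, so its derivative
    [z * t^(z-1) * exp (-t) - t^z * exp (-t)] has integral 0. *)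
Lemma Gamma_succ (z : R) : 0 < z -> Gamma (z + 1) = z * Gamma z.
Proof.
  intros Hz.
  set (H := fun t => Rpower t z * exp (- t)).
  set (h := fun t => z * gamma_density z t - gamma_density (z + 1) t).
  assert (HD : forall t, 0 < t -> is_derive H t (h t)).
  { intros t Ht. unfold H, h, gamma_density.
    replace (z + 1 - 1) with z by ring.
    replace (Rpower t (z - 1)) with (Rpower t z / t).
    2:{ unfold Rminus. rewrite Rpower_plus, Rpower_Ropp, Rpower_1 by lra. reflexivity. }
    unfold Rpower. auto_derive; [lra|]. field. lra. }
  assert (Hc : forall t, 0 < t -> continuous h t).
  { intros t Ht. apply (ex_derive_continuous h).
    unfold h, gamma_density, Rpower. auto_derive. lra. }
  assert (Hnbh : forall t, 0 < t -> locally t (fun u => 0 < u)).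
  { intros t Ht. apply (locally_interval _ _ 0 p_infty); simpl; auto. }
  assert (HI : is_RInt_gen h (at_right 0) (Rbar_locally p_infty) 0).
  { replace 0 with (0 - 0) at 2 by ring.
    apply (is_RInt_gen_ext (Derive H)).
    - eapply filter_imp; [|exact filter_prod_pos_lt].
        intros [a b]; simpl. intros (H1 & H2 & H3) t Ht.
      rewrite Rmin_left in Ht by lra. apply is_derive_unique, HD. lra.
    - apply (is_RInt_gen_Derive H).
      + eapply filter_imp; [|exact filter_prod_pos_lt].
        intros [a b]; simpl. intros (H1 & H2 & H3) t Ht.
        rewrite Rmin_left in Ht by lra. exists (h t). apply HD. lra.
      + eapply filter_imp; [|exact filter_prod_pos_lt].
        intros [a b]; simpl. intros (H1 & H2 & H3) t Ht.
        rewrite Rmin_left in Ht by lra.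
        apply continuous_ext_loc with h; [|apply Hc; lra].
        eapply filter_imp; [|exact (Hnbh t ltac:(lra))]. intros u Hu.
        symmetry. apply is_derive_unique, HD, Hu.
      + apply Rpower_exp_at_0; auto.
      + apply Rpower_exp_at_infty; auto. }
  pose proof (is_RInt_gen_minus _ _ _ _
    (is_RInt_gen_scal _ z _ (is_RInt_gen_Gamma z Hz))
    (is_RInt_gen_Gamma (z + 1) ltac:(lra))) as HJ.
  apply (@is_RInt_gen_unique R_CompleteNormedModule) in HI; try apply _.
  apply (@is_RInt_gen_unique R_CompleteNormedModule) in HJ; try apply _.
  change (fun y => minus (scal z (gamma_density z y)) (gamma_density (z + 1) y))
    with h in HJ.
  rewrite HI in HJ. unfold minus, plus, opp, scal in HJ; simpl in HJ.
  unfold mult in HJ; simpl in HJ. lra.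
Qed.

(** The tangent line at the intermediate point lies below the graph at [a] and [b]. *)
Lemma exp_convex (l a b : R) :
  0 <= l <= 1 -> exp (l * a + (1 - l) * b) <= l * exp a + (1 - l) * exp b.
Proof.
  intros Hl. set (m := l * a + (1 - l) * b).
  assert (Ht : forall y, exp m * (1 + (y - m)) <= exp y).
  { intros y. replace (exp y) with (exp m * exp (y - m)).
    - apply Rmult_le_compat_l; [apply Rlt_le, exp_pos|]. apply exp_ineq1_le.
    - rewrite <- exp_plus. f_equal. ring. }
  pose proof (Ht a) as Ha. pose proof (Ht b) as Hb.
  apply (Rmult_le_compat_l l) in Ha; [|lra].
  apply (Rmult_le_compat_l (1 - l)) in Hb; [|lra].
  replace (exp m) with (l * (exp m * (1 + (a - m))) + (1 - l) * (exp m * (1 + (b - m)))).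
  - lra.
  - unfold m; ring.
Qed.

(** This is Hölder's inequality.  After normalizing the densities at [x] and [y] by
    [Gamma x] and [Gamma y], it follows by integrating the pointwise weighted
    arithmetic-geometric inequality, which is the convexity of [exp]. *)
Lemma lnGamma_convex (l x y : R) :
  0 <= l <= 1 -> 0 < x -> 0 < y ->
  lnGamma (l * x + (1 - l) * y) <= l * lnGamma x + (1 - l) * lnGamma y.
Proof.
  intros Hl Hx Hy. set (w := l * x + (1 - l) * y).
  assert (Hw : 0 < w) by (unfold w; destruct (Req_dec l 0); [subst; lra|]; nra).
  set (m := l * lnGamma x + (1 - l) * lnGamma y).
  pose proof (Gamma_pos x Hx) as Gx. pose proof (Gamma_pos y Hy) as Gy.
  pose proof (Gamma_pos w Hw) as Gw.
  assert (HI : Gamma w <= exp m).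
  { pose proof (is_RInt_gen_scal _ (exp m) _
      (is_RInt_gen_plus _ _ _ _
        (is_RInt_gen_scal _ (l / Gamma x) _ (is_RInt_gen_Gamma x Hx))
        (is_RInt_gen_scal _ ((1 - l) / Gamma y) _ (is_RInt_gen_Gamma y Hy)))) as HR.
    apply Rle_trans with (norm (Gamma w)); [apply Rle_abs|].
    eapply Rle_trans.
    - eapply (RInt_gen_norm (V := R_CompleteNormedModule) (Fa := at_right 0)
        (Fb := Rbar_locally p_infty) (gamma_density w)); [| |apply is_RInt_gen_Gamma; auto|apply HR].
      + eapply filter_imp; [|exact filter_prod_pos_lt]. intros [a b]; simpl. lra.
      + eapply filter_imp; [|exact filter_prod_pos_lt]. intros [a b]; simpl.
        intros (H1 & H2 & H3) t Ht.
        unfold norm, scal, plus; simpl. unfold mult, abs; simpl.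
        rewrite Rabs_pos_eq by apply Rlt_le, gamma_density_pos.
        pose proof (exp_convex l ((x - 1) * ln t - lnGamma x)
                      ((y - 1) * ln t - lnGamma y) Hl) as HE.
        replace (l * ((x - 1) * ln t - lnGamma x) + (1 - l) * ((y - 1) * ln t - lnGamma y))
          with ((w - 1) * ln t - m) in HE by (unfold w, m; ring).
        assert (Hq : forall u v, exp (u - v) = exp u * / exp v).
        { intros u v. rewrite <- exp_Ropp, <- exp_plus. reflexivity. }
        rewrite !Hq in HE. unfold lnGamma in HE. rewrite !exp_ln in HE by auto.
        fold (Rpower t (w - 1)) (Rpower t (x - 1)) (Rpower t (y - 1)) in HE.
        unfold gamma_density.
        pose proof (exp_pos m) as Em. pose proof (exp_pos (- t)) as Et.
        apply (Rmult_le_compat_r (exp m * exp (- t))) in HE; [|nra].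
        replace (Rpower t (w - 1) * exp (- t))
          with (Rpower t (w - 1) * / exp m * (exp m * exp (- t))) by (field; lra).
        eapply Rle_trans; [apply HE|]. apply Req_le. field. lra.
    - unfold scal, plus; simpl. unfold mult; simpl. apply Req_le. field. lra. }
  unfold lnGamma at 1. rewrite <- (ln_exp m). apply ln_le; auto.
Qed.

Lemma lnGamma_succ (x : R) : 0 < x -> lnGamma (x + 1) = lnGamma x + ln x.
Proof.
  intros Hx. unfold lnGamma. rewrite Gamma_succ, ln_mult; auto using Gamma_pos. ring.
Qed.

(** * Increments of lnGamma *)

(** Slopes of chords of a convex function increase, written without division. *)
Lemma lnGamma_chord (x y z : R) :
  0 < x -> x < y -> y < z ->
  (lnGamma y - lnGamma x) * (z - y) <= (lnGamma z - lnGamma y) * (y - x).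
Proof.
  intros Hx Hxy Hyz. set (l := (z - y) / (z - x)).
  assert (Hl : l * (z - x) = z - y) by (unfold l; field; lra).
  pose proof (lnGamma_convex l x z ltac:(split; nra) Hx ltac:(lra)) as H.
  replace (l * x + (1 - l) * z) with y in H by lra.
  apply (Rmult_le_compat_r (z - x)) in H; [|lra].
  replace ((l * lnGamma x + (1 - l) * lnGamma z) * (z - x))
    with (l * (z - x) * lnGamma x + (z - x - l * (z - x)) * lnGamma z) in H by ring.
  rewrite Hl in H. lra.
Qed.

Definition lnGamma_incr (s x : R) : R := lnGamma (x + s) - lnGamma x.

(** The chord over [[x, x + s]] is compared with the unit chord to its left, whose
    slope [ln (x - 1)] is given by the functional equation. *)
Lemma lnGamma_incr_lower (s x : R) :
  0 < s -> 1 < x -> s * ln (x - 1) <= lnGamma_incr s x.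
Proof.
  intros Hs Hx. pose proof (lnGamma_chord (x - 1) x (x + s)) as H.
  pose proof (lnGamma_succ (x - 1) ltac:(lra)) as HS.
  replace (x - 1 + 1) with x in HS by ring.
  unfold lnGamma_incr. rewrite HS in H at 1.
  specialize (H ltac:(lra) ltac:(lra) ltac:(lra)). lra.
Qed.

(** As above, with the unit chord to the right, of slope [ln (x + s)]. *)
Lemma lnGamma_incr_upper (s x : R) :
  0 < s -> 0 < x -> lnGamma_incr s x <= s * ln (x + s).
Proof.
  intros Hs Hx. pose proof (lnGamma_chord x (x + s) (x + s + 1)) as H.
  rewrite (lnGamma_succ (x + s)) in H by lra.
  unfold lnGamma_incr. specialize (H ltac:(lra) ltac:(lra) ltac:(lra)). lra.
Qed.

Lemma lnGamma_incr_succ (s x : R) :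
  0 < s -> 0 < x ->
  lnGamma_incr s (x + 1) = lnGamma_incr s x + (ln (x + s) - ln x).
Proof.
  intros Hs Hx. unfold lnGamma_incr.
  replace (x + 1 + s) with (x + s + 1) by ring.
  rewrite !lnGamma_succ by lra. ring.
Qed.

(** Both increments are [s * ln k] up to [o(1)].  The statement is one-sided; exchanging
    [x] and [y] gives the other side. *)
Lemma lnGamma_incr_shift (s x y eps : R) :
  0 < s -> 0 < x -> 0 < y -> 0 < eps ->
  exists N : nat, forall k : nat, (N <= k)%nat ->
    lnGamma_incr s (x + INR k) - lnGamma_incr s (y + INR k) <= eps.
Proof.
  intros Hs Hx Hy He.
  set (B := s * Rabs (x + s - y + 1)).
  destruct (nfloor_ex (B / eps + 1)) as [N [_ HN]].
  { unfold B. pose proof (Rabs_pos (x + s - y + 1)).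
    assert (0 <= s * Rabs (x + s - y + 1) / eps).
    { apply Rmult_le_pos; [nra|apply Rlt_le, Rinv_0_lt_compat; auto]. }
    lra. }
  exists (S N). intros k Hk. apply le_INR in Hk. rewrite S_INR in Hk.
  assert (HB : 0 <= B) by (unfold B; pose proof (Rabs_pos (x + s - y + 1)); nra).
  assert (HBe : 0 <= B / eps).
  { apply Rmult_le_pos; [auto|apply Rlt_le, Rinv_0_lt_compat; auto]. }
  pose proof (lnGamma_incr_upper s (x + INR k) Hs ltac:(lra)) as H1.
  pose proof (lnGamma_incr_lower s (y + INR k) Hs ltac:(lra)) as H2.
  set (q := y + INR k - 1) in *.
  assert (Hq : B / eps < q) by (unfold q; lra).
  assert (H3 : ln (x + INR k + s) - ln q <= (x + s - y + 1) / q).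
  { rewrite <- ln_div by lra. eapply Rle_trans.
    - apply ln_le_sub1. apply Rdiv_lt_0_compat; lra.
    - apply Req_le. unfold q. field. unfold q in Hq. lra. }
  apply Rle_trans with (s * ((x + s - y + 1) / q)); [nra|].
  apply Rmult_le_reg_r with q; [lra|].
  replace (s * ((x + s - y + 1) / q) * q) with (s * (x + s - y + 1)) by (field; lra).
  apply Rle_trans with B.
  - unfold B. apply Rmult_le_compat_l; [lra|apply Rle_abs].
  - apply Rlt_le. apply Rmult_lt_compat_r with (r := eps) in Hq; [|auto].
    replace (B / eps * eps) with B in Hq by (field; lra). lra.
Qed.

(** The device for comparing increments: a difference that only grows under the shift
    [k -> k + 1] and dies out as [k] grows must start nonpositive. *)
Lemma nondecr_limsup_nonpos (E : nat -> R) :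
  (forall k, E k <= E (S k)) ->
  (forall eps, 0 < eps -> exists k, E k <= eps) -> E 0%nat <= 0.
Proof.
  intros Hm Hl. apply Rnot_lt_le. intros H0.
  destruct (Hl (E 0%nat / 2) ltac:(lra)) as [k Hk].
  assert (E 0%nat <= E k).
  { clear Hk. induction k; [lra|]. specialize (Hm k). lra. }
  lra.
Qed.

(** The chord bounds squeeze [lnGamma y - lnGamma x] between expressions that vanish
    as [y -> x].  For the lower one the chord is first shifted by 1, so that the unit
    chord to its left stays in the positive half-line. *)
Lemma lnGamma_continuous (x : R) : 0 < x -> continuous lnGamma x.
Proof.
  intros Hx.
  assert (Hab : forall a b, 0 < a -> a < b ->
    Rabs (lnGamma b - lnGamma a) <=
    (b - a) * (Rabs (ln a) + Rabs (ln b)) + (ln b - ln a)).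
  { intros a b Ha Hb.
    pose proof (lnGamma_incr_upper (b - a) a ltac:(lra) Ha) as HU.
    pose proof (lnGamma_incr_lower (b - a) (a + 1) ltac:(lra) ltac:(lra)) as HL.
    rewrite lnGamma_incr_succ in HL by lra. unfold lnGamma_incr in *.
    replace (a + (b - a)) with b in * by ring. replace (a + 1 - 1) with a in HL by ring.
    pose proof (ln_increasing a b Ha Hb).
    pose proof (Rle_abs (ln a)). pose proof (Rle_abs (ln b)).
    pose proof (Rle_abs (- ln a)) as Hna. rewrite Rabs_Ropp in Hna.
    pose proof (Rabs_pos (ln a)). pose proof (Rabs_pos (ln b)).
    apply Rabs_le. split; nra. }
  set (r := fun y => Rabs (y - x) * (Rabs (ln x) + Rabs (ln y)) + Rabs (ln y - ln x)).
  assert (Hr : forall y, 0 < y -> Rabs (lnGamma y - lnGamma x) <= r y).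
  { intros y Hy. unfold r. destruct (Rtotal_order x y) as [H|[H|H]].
    - rewrite (Rabs_pos_eq (y - x)) by lra.
      pose proof (ln_increasing x y Hx H).
      rewrite (Rabs_pos_eq (ln y - ln x)) by lra. apply Hab; auto.
    - subst. rewrite !Rminus_diag, Rabs_R0. lra.
    - rewrite (Rabs_minus_sym y x), (Rabs_minus_sym (ln y)), (Rabs_minus_sym (lnGamma y)).
      rewrite (Rabs_pos_eq (x - y)) by lra.
      pose proof (ln_increasing y x Hy H).
      rewrite (Rabs_pos_eq (ln x - ln y)) by lra. rewrite (Rplus_comm (Rabs (ln x))).
      apply Hab; auto. }
  assert (Hrc : continuous r x).
  { assert (Hln : continuous ln x).
    { apply (ex_derive_continuous ln). auto_derive. auto. }
    assert (Hid : continuous (fun y => Rabs (y - x)) x).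
    { apply continuous_comp; [|apply continuous_Rabs].
      apply (continuous_minus (fun y : R => y) (fun _ => x));
        [apply continuous_id|apply continuous_const]. }
    apply (continuous_plus (fun y => Rabs (y - x) * (Rabs (ln x) + Rabs (ln y)))
                           (fun y => Rabs (ln y - ln x))).
    - apply (continuous_mult (fun y => Rabs (y - x)) (fun y => Rabs (ln x) + Rabs (ln y)));
        [apply Hid|].
      apply (continuous_plus (fun _ => Rabs (ln x)) (fun y => Rabs (ln y)));
        [apply continuous_const|].
      apply continuous_comp; [apply Hln|apply continuous_Rabs].
    - apply (continuous_comp (fun y => ln y - ln x)); [|apply continuous_Rabs].
      apply (continuous_minus ln (fun _ => ln x)); [apply Hln|apply continuous_const]. }
  apply filterlim_locally. intros eps.
  pose proof (proj1 (filterlim_locally _ _) Hrc eps) as Hball.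
  assert (Hpos : locally x (fun y => 0 < y)).
  { apply (locally_interval _ _ 0 p_infty); simpl; auto. }
  eapply filter_imp; [|exact (filter_and _ _ Hball Hpos)].
  intros y [Hb Hy].
  assert (Hrx : r x = 0) by (unfold r; rewrite !Rminus_diag, Rabs_R0; ring).
  unfold ball in Hb |- *; simpl in Hb |- *; unfold AbsRing_ball in Hb |- *.
  unfold abs, minus, plus, opp in Hb |- *; simpl in Hb |- *.
  rewrite Hrx in Hb.
  replace (r y + - 0) with (r y) in Hb by ring.
  eapply Rle_lt_trans; [apply (Hr y Hy)|].
  eapply Rle_lt_trans; [apply Rle_abs|exact Hb].
Qed.

(** * Symmetric sums of increments *)

Definition sym_incr (s d u : R) : R := lnGamma_incr s (d + u) + lnGamma_incr s (d - u).

(** The change of [sym_incr s d u] when [d] is replaced by [d + 1], with opposite sign;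
    it is the logarithm of [(d^2 - u^2) / ((d+s)^2 - u^2)]. *)
Definition sym_log (s d u : R) : R :=
  ln (d + u) + ln (d - u) - ln (d + s + u) - ln (d + s - u).

Lemma sym_log_decr (s d u v : R) :
  0 < s -> 0 <= v -> v < u -> u < d -> sym_log s d u < sym_log s d v.
Proof.
  intros Hs Hv Hvu Hu. unfold sym_log.
  assert (H : ln ((d + u) * (d - u) * ((d + s + v) * (d + s - v)))
            < ln ((d + v) * (d - v) * ((d + s + u) * (d + s - u)))).
  { apply ln_increasing.
    - repeat apply Rmult_lt_0_compat; lra.
    - assert (0 < (u ^ 2 - v ^ 2) * ((d + s) ^ 2 - d ^ 2)).
      { apply Rmult_lt_0_compat; nra. }
      nra. }
  rewrite !ln_mult in H; try lra; repeat apply Rmult_lt_0_compat; lra.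
Qed.

Lemma sym_incr_succ (s d u : R) :
  0 < s -> 0 <= u < d -> sym_incr s (d + 1) u = sym_incr s d u - sym_log s d u.
Proof.
  intros Hs Hu. unfold sym_incr, sym_log.
  replace (d + 1 + u) with (d + u + 1) by ring.
  replace (d + 1 - u) with (d - u + 1) by ring.
  rewrite !lnGamma_incr_succ by lra.
  replace (d + s + u) with (d + u + s) by ring.
  replace (d + s - u) with (d - u + s) by ring. ring.
Qed.

(** Shifting [d] to [d + 1] raises the difference [sym_incr s d u - sym_incr s d v]
    by a positive amount, and the difference tends to 0 along such shifts. *)
Lemma sym_incr_le (s d u v : R) :
  0 < s -> 0 <= v -> v < u -> u < d -> sym_incr s d u <= sym_incr s d v.
Proof.
  intros Hs Hv Hvu Hu.
  pose proof (nondecr_limsup_nonpos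
    (fun k => sym_incr s (d + INR k) u - sym_incr s (d + INR k) v)) as H.
  simpl in H. rewrite Rplus_0_r in H. cut (sym_incr s d u - sym_incr s d v <= 0); [lra|].
  apply H.
  - intros k. pose proof (pos_INR k).
    change (match k with 0%nat => 1 | S _ => INR k + 1 end) with (INR (S k)).
    rewrite S_INR, <- Rplus_assoc, !sym_incr_succ by lra.
    pose proof (sym_log_decr s (d + INR k) u v Hs Hv Hvu ltac:(lra)). lra.
  - intros eps He.
    destruct (lnGamma_incr_shift s (d + u) (d + v) (eps / 2)) as [N1 H1]; try lra.
    destruct (lnGamma_incr_shift s (d - u) (d - v) (eps / 2)) as [N2 H2]; try lra.
    exists (Nat.max N1 N2). set (k := Nat.max N1 N2).
    specialize (H1 k ltac:(lia)). specialize (H2 k ltac:(lia)). unfold sym_incr.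
    replace (d + INR k + u) with (d + u + INR k) by ring.
    replace (d + INR k - u) with (d - u + INR k) by ring.
    replace (d + INR k + v) with (d + v + INR k) by ring.
    replace (d + INR k - v) with (d - v + INR k) by ring. lra.
Qed.

(** Weak monotonicity at [d + 1], read back at [d], keeps the contribution of the first
    shift.  That single term yields both strictness and divergence at [u = d]. *)
Lemma sym_incr_decr_by_log (s d u v : R) :
  0 < s -> 0 <= v -> v < u -> u < d ->
  sym_incr s d u - sym_incr s d v <= sym_log s d u - sym_log s d v.
Proof.
  intros Hs Hv Hvu Hu.
  pose proof (sym_incr_le s (d + 1) u v Hs Hv Hvu ltac:(lra)) as H.
  rewrite !sym_incr_succ in H by lra. lra.
Qed.

Lemma sym_incr_strict_decr (s d u v : R) :
  0 < s -> 0 <= v -> v < u -> u < d -> sym_incr s d u < sym_incr s d v.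
Proof.
  intros Hs Hv Hvu Hu.
  pose proof (sym_incr_decr_by_log s d u v Hs Hv Hvu Hu).
  pose proof (sym_log_decr s d u v Hs Hv Hvu Hu). lra.
Qed.

(** At [u = d - e] the logarithmic bound contains [ln e], and its other terms are
    controlled independently of [e]. *)
Lemma sym_incr_unbounded_below (s d v M : R) :
  0 < s -> 0 <= v -> v < d -> exists u, v < u /\ u < d /\ sym_incr s d u < M.
Proof.
  intros Hs Hv Hd.
  set (A := sym_incr s d v - sym_log s d v).
  set (e := Rmin ((d - v) / 2) (exp (M - A + ln s - 1))).
  assert (He : 0 < e) by (apply Rmin_glb_lt; [lra|apply exp_pos]).
  assert (He1 : e <= (d - v) / 2) by apply Rmin_l.
  assert (He2 : ln e <= M - A + ln s - 1).
  { rewrite <- (ln_exp (M - A + ln s - 1)). apply ln_le; [auto|apply Rmin_r]. }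
  exists (d - e). repeat split; try lra.
  pose proof (sym_incr_decr_by_log s d (d - e) v Hs Hv ltac:(lra) ltac:(lra)) as H.
  unfold sym_log at 1 in H.
  replace (d - (d - e)) with e in H by ring.
  pose proof (ln_increasing (d + (d - e)) (d + s + (d - e)) ltac:(lra) ltac:(lra)).
  pose proof (ln_increasing s (d + s - (d - e)) ltac:(lra) ltac:(lra)).
  unfold A in *. lra.
Qed.

Lemma sym_incr_continuous (s d u : R) :
  0 < s -> - d < u < d -> continuous (sym_incr s d) u.
Proof.
  intros Hs Hu. unfold sym_incr, lnGamma_incr.
  assert (Haff : forall e b, 0 < b + e * u -> continuous (fun w => lnGamma (b + e * w)) u).
  { intros e b Hb. apply continuous_comp; [|apply lnGamma_continuous; auto].
    apply (ex_derive_continuous (fun w => b + e * w)). auto_derive. auto. }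
  apply continuous_ext with (fun w =>
    (lnGamma (d + s + 1 * w) - lnGamma (d + 1 * w))
    + (lnGamma (d + s + (-1) * w) - lnGamma (d + (-1) * w))).
  { intros w. replace (d + s + 1 * w) with (d + w + s) by ring.
    replace (d + 1 * w) with (d + w) by ring.
    replace (d + s + -1 * w) with (d - w + s) by ring.
    replace (d + -1 * w) with (d - w) by ring. reflexivity. }
  apply (continuous_plus (fun w => lnGamma (d + s + 1 * w) - lnGamma (d + 1 * w))
           (fun w => lnGamma (d + s + (-1) * w) - lnGamma (d + (-1) * w)));
  [apply (continuous_minus (fun w => lnGamma (d + s + 1 * w)) (fun w => lnGamma (d + 1 * w)))
  |apply (continuous_minus (fun w => lnGamma (d + s + (-1) * w))
            (fun w => lnGamma (d + (-1) * w)))];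
  apply Haff; lra.
Qed.

Lemma sym_incr_reaches (s d v M : R) :
  0 < s -> 0 <= v -> v < d -> M < sym_incr s d v ->
  exists u, v < u /\ u < d /\ sym_incr s d u = M.
Proof.
  intros Hs Hv Hd HM.
  destruct (sym_incr_unbounded_below s d v M Hs Hv Hd) as (w & Hw1 & Hw2 & Hw3).
  destruct (Ranalysis5.IVT_interv (fun u => M - sym_incr s d u) v w) as (u & Hu & Hu0); try lra.
  - intros u Hu. apply continuity_pt_filterlim.
    apply (continuous_minus (fun _ => M) (sym_incr s d)); [apply continuous_const|].
    apply sym_incr_continuous; lra.
  - exists u. destruct (Req_dec u v) as [->|]; lra.
Qed.

(** * The gap at the endpoint *)

(** The difference between the two sides of the reduced equation at [u = c - 1/2], the
    parameter at which the smaller candidate [x = c - 1/2 - u] reaches 0. *)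
Definition endpoint_gap (s c : R) : R :=
  lnGamma_incr s (2 * c) + lnGamma_incr s 1 - 2 * lnGamma_incr s c.

(** The factor [(2x+k) (x+k+s)^2 / ((2x+k+s) (x+k)^2)] decreases in [x].  With
    [y = x + e], the difference of the cross products expands to [s * e] times a
    polynomial in [x, e, k, s] with positive coefficients.  The square is essential: with
    the first power of [(x+k+s)/(x+k)] the quotient need not be monotone. *)
Lemma endpoint_factor_decr (s x y k : R) :
  0 < s -> 0 < x -> x < y -> 0 <= k ->
  (2 * y + k) * (y + k + s) ^ 2 * ((2 * x + k + s) * (x + k) ^ 2)
  <= (2 * y + k + s) * (y + k) ^ 2 * ((2 * x + k) * (x + k + s) ^ 2).
Proof.
  intros Hs Hx Hxy Hk. set (e := y - x). assert (He : 0 < e) by (unfold e; lra).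
  replace y with (x + e) by (unfold e; ring). clearbody e. clear y Hxy.
  apply Rminus_le_0.
  match goal with |- 0 <= ?L => replace L with (s * e *
    (6 * x ^ 4 + 16 * x ^ 3 * k + 8 * x ^ 3 * s + 14 * x ^ 2 * k ^ 2
     + 14 * x ^ 2 * k * s + 12 * x ^ 3 * e + 24 * x ^ 2 * e * k + 12 * x ^ 2 * e * s
     + 14 * x * e * k ^ 2 + 14 * x * e * k * s + 4 * x * k ^ 3 + 6 * x * k ^ 2 * s
     + 6 * x ^ 2 * e ^ 2 + 8 * x * e ^ 2 * k + 4 * x * e ^ 2 * s + 2 * e ^ 2 * k ^ 2
     + 2 * e ^ 2 * k * s + 2 * e * k ^ 3 + 3 * e * k ^ 2 * s + 2 * x ^ 2 * s ^ 2
     + 2 * x * k * s ^ 2 + 2 * x * e * s ^ 2 + e * k * s ^ 2)) by ring end.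
  repeat first [apply Rplus_le_le_0_compat | apply Rmult_le_pos | apply pow_le | lra].
Qed.

(** The difference of the gaps at [y] and [x], with all arguments shifted by [k], changes
    from [k] to [k + 1] by the logarithm of a quotient of the factors of
    [endpoint_factor_decr], and it tends to 0. *)
Lemma endpoint_gap_decr (s x y : R) :
  0 < s -> 0 < x -> x < y -> endpoint_gap s y <= endpoint_gap s x.
Proof.
  intros Hs Hx Hxy.
  set (E := fun k : nat =>
    (lnGamma_incr s (2 * y + INR k) - lnGamma_incr s (2 * x + INR k))
    + 2 * (lnGamma_incr s (x + INR k) - lnGamma_incr s (y + INR k))).
  assert (H : E 0%nat <= 0).
  { apply nondecr_limsup_nonpos.
    - intros k. unfold E. rewrite S_INR, <- !Rplus_assoc.
      pose proof (pos_INR k) as Hk. set (K := INR k) in *.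
      rewrite !lnGamma_incr_succ by lra.
      pose proof (endpoint_factor_decr s x y K Hs Hx Hxy Hk) as HP.
      apply ln_le in HP.
      2:{ repeat first [apply Rmult_lt_0_compat | apply pow_lt]; lra. }
      rewrite !ln_mult in HP;
        try (repeat first [apply Rmult_lt_0_compat | apply pow_lt]; lra).
      rewrite !ln_pow in HP by lra. simpl in HP. lra.
    - intros eps He.
      destruct (lnGamma_incr_shift s (2 * y) (2 * x) (eps / 3)) as [N1 H1]; try lra.
      destruct (lnGamma_incr_shift s x y (eps / 3)) as [N2 H2]; try lra.
      exists (Nat.max N1 N2). specialize (H1 (Nat.max N1 N2) ltac:(lia)).
      specialize (H2 (Nat.max N1 N2) ltac:(lia)). unfold E. lra. }
  unfold E in H. simpl in H. rewrite !Rplus_0_r in H. unfold endpoint_gap. lra.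
Qed.

(** The chord bounds give [D (2c) - 2 D c <= s * (ln (2c+s) - 2 ln (c-1))], which behaves
    like [- s * ln c]. *)
Lemma endpoint_gap_eventually_neg (s : R) :
  0 < s -> exists c0, forall c, c0 < c -> endpoint_gap s c < 0.
Proof.
  intros Hs. set (B := ln 4 + lnGamma_incr s 1 / s).
  exists (s / 2 + 2 + exp B). intros c Hc. pose proof (exp_pos B) as HB.
  pose proof (lnGamma_incr_upper s (2 * c) Hs ltac:(lra)) as HU.
  pose proof (lnGamma_incr_lower s c Hs ltac:(lra)) as HL.
  pose proof (ln_le (2 * c + s) (4 * (c - 1)) ltac:(lra) ltac:(lra)) as H4.
  rewrite ln_mult in H4 by lra.
  pose proof (ln_increasing (exp B) (c - 1) HB ltac:(lra)) as HE. rewrite ln_exp in HE.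
  assert (HsB : s * B = s * ln 4 + lnGamma_incr s 1) by (unfold B; field; lra).
  unfold endpoint_gap. nra.
Qed.

(** * From the equation to symmetric sums, and the threshold *)

Lemma nat_threshold (Q : nat -> Prop) :
  ~ Q 1%nat -> (exists N, Q N) -> (forall m n, (m <= n)%nat -> Q m -> Q n) ->
  exists n0, (0 < n0)%nat /\ forall n, (n <= n0)%nat <-> ~ Q n.
Proof.
  intros H1 [N HN] Hup.
  induction N as [|N IH].
  - exfalso. apply H1, (Hup 0%nat); auto.
  - destruct (Classical_Prop.classic (Q N)) as [HQ|HQ]; [auto|].
    exists N. split.
    + destruct N; [exfalso; auto|lia].
    + intros n. split.
      * intros Hn Hq. apply HQ, (Hup n); auto.
      * intros Hn. apply Nat.nlt_ge. intros Hlt. apply Hn, (Hup (S N)); auto.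
Qed.

Lemma sym_incr_even (s d u : R) : sym_incr s d (- u) = sym_incr s d u.
Proof.
  unfold sym_incr, Rminus. rewrite Ropp_involutive. ring.
Qed.

(** At [u = 1/2] the two arguments are [c + 1] and [c], so the functional equation
    evaluates the excess as [ln ((c+s)/c)]. *)
Lemma sym_incr_half (s c : R) :
  0 < s -> 0 < c -> 2 * lnGamma_incr s c < sym_incr s (c + 1 / 2) (1 / 2).
Proof.
  intros Hs Hc. unfold sym_incr.
  replace (c + 1 / 2 + 1 / 2) with (c + 1) by field.
  replace (c + 1 / 2 - 1 / 2) with c by field.
  rewrite lnGamma_incr_succ by lra.
  pose proof (ln_increasing c (c + s) ltac:(lra) ltac:(lra)). lra.
Qed.

Lemma sym_incr_endpoint (s c : R) :
  sym_incr s (c + 1 / 2) (c - 1 / 2) - 2 * lnGamma_incr s c = endpoint_gap s c.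
Proof.
  unfold sym_incr, endpoint_gap.
  replace (c + 1 / 2 + (c - 1 / 2)) with (2 * c) by field.
  replace (c + 1 / 2 - (c - 1 / 2)) with 1 by field. ring.
Qed.

(** Evenness reduces to [u >= 0], where strict monotonicity gives uniqueness and the
    intermediate value theorem on [(1/2, c + 1/2)] gives existence. *)
Lemma sym_incr_unique_level (s c : R) :
  0 < s -> 0 < c ->
  exists u0, 1 / 2 < u0 /\ u0 < c + 1 / 2 /\
    forall u, Rabs u < c + 1 / 2 ->
      (sym_incr s (c + 1 / 2) u = 2 * lnGamma_incr s c <-> Rabs u = u0).
Proof.
  intros Hs Hc.
  destruct (sym_incr_reaches s (c + 1 / 2) (1 / 2) (2 * lnGamma_incr s c))
    as (u0 & H1 & H2 & H3); try lra.
  { apply sym_incr_half; auto. }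
  exists u0. split; [auto|split; [auto|]]. intros u Hu.
  assert (Habs : sym_incr s (c + 1 / 2) u = sym_incr s (c + 1 / 2) (Rabs u)).
  { unfold Rabs. destruct (Rcase_abs u); [rewrite sym_incr_even|]; reflexivity. }
  rewrite Habs. pose proof (Rabs_pos u) as Hp. split; [|intros ->; auto].
  intros He. destruct (Rtotal_order (Rabs u) u0) as [H|[H|H]]; auto.
  - pose proof (sym_incr_strict_decr s (c + 1 / 2) u0 (Rabs u)). lra.
  - pose proof (sym_incr_strict_decr s (c + 1 / 2) (Rabs u) u0). lra.
Qed.

Lemma f_eq_sym_incr (n : nat) (s a : R) :
  Defs.f n s a = sym_incr s (INR n / 4 - s / 2 + 1 / 2) (a * sqrt (INR n) / 2)
            - 2 * lnGamma_incr s (INR n / 4 - s / 2).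
Proof.
  unfold Defs.f, sym_incr, lnGamma_incr.
  set (r := sqrt (INR n)).
  replace (INR n / 4 - s / 2 + 1 / 2 + a * r / 2 + s)
    with (INR n / 4 + s / 2 + 1 / 2 + 1 / 2 * a * r) by field.
  replace (INR n / 4 - s / 2 + 1 / 2 - a * r / 2 + s)
    with (INR n / 4 + s / 2 + 1 / 2 - 1 / 2 * a * r) by field.
  replace (INR n / 4 - s / 2 + 1 / 2 + a * r / 2)
    with (INR n / 4 - s / 2 + 1 / 2 + 1 / 2 * a * r) by field.
  replace (INR n / 4 - s / 2 + 1 / 2 - a * r / 2)
    with (INR n / 4 - s / 2 + 1 / 2 - 1 / 2 * a * r) by field.
  replace (INR n / 4 - s / 2 + s) with (INR n / 4 + s / 2) by field.
  ring.
Qed.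

(** The factor [p = (x+s)/x] is absorbed by the functional equation: it turns
    [Gamma (s+x) / Gamma x] into [Gamma (x+s+1) / Gamma (x+1)].  Both sides of the
    equation are positive, so taking logarithms loses nothing. *)
Lemma eqE_iff_sym_incr (n : nat) (s c x : R) :
  0 < s -> c = INR n / 4 - s / 2 -> 0 < x -> x < 2 * c ->
  (eqE n s ((x + s) / x)
   <-> sym_incr s (c + 1 / 2) (x - (c - 1 / 2)) = 2 * lnGamma_incr s c).
Proof.
  intros Hs Hc Hx Hx2. unfold eqE, sym_incr, lnGamma_incr.
  replace (s / ((x + s) / x - 1)) with x by (field; lra).
  replace (INR n / 2 - x) with (2 * c - x + s) by (rewrite Hc; field).
  replace ((INR n - 2 * s) / 2 - x) with (2 * c - x) by (rewrite Hc; field).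
  replace ((INR n + 2 * s) / 4) with (c + s) by (rewrite Hc; field).
  replace ((INR n - 2 * s) / 4) with c by (rewrite Hc; field).
  replace (c + 1 / 2 + (x - (c - 1 / 2))) with (x + 1) by field.
  replace (c + 1 / 2 - (x - (c - 1 / 2))) with (2 * c - x) by field.
  replace (x + 1 + s) with (s + x + 1) by ring.
  rewrite !lnGamma_succ by lra. unfold lnGamma.
  pose proof (Gamma_pos (2 * c - x + s) ltac:(lra)) as P1.
  pose proof (Gamma_pos (s + x) ltac:(lra)) as P2.
  pose proof (Gamma_pos x ltac:(lra)) as P3.
  pose proof (Gamma_pos (2 * c - x) ltac:(lra)) as P4.
  pose proof (Gamma_pos (c + s) ltac:(lra)) as P5.
  pose proof (Gamma_pos c ltac:(lra)) as P6.
  clear Hc.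
  set (g1 := Gamma (2 * c - x + s)) in *. set (g2 := Gamma (s + x)) in *.
  set (g3 := Gamma x) in *. set (g4 := Gamma (2 * c - x)) in *.
  set (g5 := Gamma (c + s)) in *. set (g6 := Gamma c) in *.
  set (A := (x + s) / x * (g1 * g2 / (g3 * g4))).
  set (B := g5 ^ 2 / g6 ^ 2).
  assert (HA : ln A = ln g2 + ln (s + x) - (ln g3 + ln x) + (ln g1 - ln g4)).
  { unfold A. rewrite ln_mult, !ln_div, !ln_mult, (Rplus_comm x s);
      try lra; try apply Rdiv_lt_0_compat; try apply Rmult_lt_0_compat; lra. }
  assert (HB : ln B = 2 * (ln g5 - ln g6)).
  { unfold B. rewrite ln_div, !ln_pow by (try apply pow_lt; lra). simpl. ring. }
  rewrite <- HA, <- HB. split; [intros ->; auto|].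
  apply ln_inv; [unfold A|unfold B];
    repeat first [apply Rmult_lt_0_compat | apply Rinv_0_lt_compat | apply pow_lt | lra].
Qed.

(** The map [p -> s/(p-1)] is a bijection from [p > n/(n-2s)] onto [(0, 2c)]. *)
Lemma rootE_iff_param (n : nat) (s c p : R) :
  0 < s -> c = INR n / 4 - s / 2 -> 0 < c ->
  (rootE n s p <-> exists x, 0 < x < 2 * c /\ p = (x + s) / x /\
     sym_incr s (c + 1 / 2) (x - (c - 1 / 2)) = 2 * lnGamma_incr s c).
Proof.
  intros Hs Hc Hc0. unfold rootE.
  replace (INR n / (INR n - 2 * s)) with (1 + s / (2 * c)) by (rewrite Hc; field; lra).
  split.
  - intros [Hp HE]. set (x := s / (p - 1)).
    assert (0 < s / (2 * c)) by (apply Rdiv_lt_0_compat; lra).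
    assert (Hx : 0 < x) by (apply Rdiv_lt_0_compat; lra).
    assert (Hpx : p = (x + s) / x) by (unfold x; field; lra).
    assert (Hx2 : x < 2 * c).
    { assert (H2 : s / (2 * c) < p - 1) by lra.
      apply Rmult_lt_compat_r with (r := 2 * c / (p - 1)) in H2.
      - replace (s / (2 * c) * (2 * c / (p - 1))) with x in H2 by (unfold x; field; lra).
        replace ((p - 1) * (2 * c / (p - 1))) with (2 * c) in H2 by (field; lra). auto.
      - apply Rdiv_lt_0_compat; lra. }
    exists x. split; [auto|split; [auto|]].
    rewrite Hpx in HE. apply (eqE_iff_sym_incr n s c x); auto.
  - intros (x & Hx & -> & HE). split.
    + replace ((x + s) / x) with (1 + s / x) by (field; lra).
      apply Rplus_lt_compat_l, Rmult_lt_compat_l; [auto|].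
      apply Rinv_lt_contravar; [nra|lra].
    + apply (eqE_iff_sym_incr n s c x); auto; lra.
Qed.

Theorem theorem1p1 (s : R) (hs : 0 < s) :
  exists n0 : nat, (0 < n0)%nat /\
    forall n : nat, (0 < n)%nat -> 2 * s < INR n ->
      exists a : R,
        unique (positive_root_f n s) a
        /\ ((n <= n0)%nat ->
              1 / sqrt (INR n) < a
              /\ a < 1 / 2 * ((INR n - 2 * s) / sqrt (INR n)) + 1 / sqrt (INR n)
              /\ den1 n s a <> 0
              /\ (forall p : R, rootE n s p <-> p = p1 n s a))
        /\ ((n0 < n)%nat ->
              den1 n s a <> 0
              /\ den2 n s a <> 0
              /\ (forall p : R, rootE n s p <-> p = p1 n s a \/ p = p2 n s a)
              /\ INR n / (INR n - 2 * s) < p1 n s a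
              /\ p1 n s a < (INR n + 2 * s) / (INR n - 2 * s)
              /\ (INR n + 2 * s) / (INR n - 2 * s) < p2 n s a
              /\ Rbar_lt (Finite (p2 n s a)) p_infty).
Proof.
  (* For [n > 2s], [Q n] says that the second root exists; it fails at [n = 1], which makes the
     threshold positive. *)
  set (Q := fun n : nat => 1 / 2 < INR n / 4 - s / 2 /\ endpoint_gap s (INR n / 4 - s / 2) < 0).
  destruct (nat_threshold Q) as (n0 & Hn0 & HQ).
  { intros [H _]. simpl in H. lra. }
  { destruct (endpoint_gap_eventually_neg s hs) as [c0 Hc0].
    destruct (INR_unbounded (4 * Rabs c0 + 2 * s + 2)) as [N HN].
    pose proof (Rle_abs c0). pose proof (Rabs_pos c0).
    exists N. split; [lra|]. apply Hc0. lra. }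
  { intros m n Hmn [H1 H2]. destruct (Nat.eq_dec m n) as [->|Hne]; [split; auto|].
    assert (Hlt : INR m < INR n) by (apply lt_INR; lia).
    split; [lra|]. eapply Rle_lt_trans; [apply endpoint_gap_decr with (x := INR m / 4 - s / 2)|]; lra. }
  exists n0. split; [auto|]. intros n Hn Hsn.
  set (c := INR n / 4 - s / 2) in *.
  assert (Hc : 0 < c) by (unfold c; lra).
  set (r := sqrt (INR n)). assert (Hr : 0 < r) by (apply sqrt_lt_R0; lra).
  destruct (sym_incr_unique_level s c hs Hc) as (u0 & Hu1 & Hu2 & Hu).
  set (a := 2 * u0 / r).
  assert (Har : 2 * a * r = 4 * u0) by (unfold a; field; lra).
  assert (Hd1 : den1 n s a = 4 * (c - 1 / 2 + u0)).
  { unfold den1. fold r. rewrite Har. unfold c. field. }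
  assert (Hd2 : den2 n s a = 4 * (c - 1 / 2 - u0)).
  { unfold den2. fold r. rewrite Har. unfold c. field. }
  set (x1 := c - 1 / 2 + u0) in *. set (x2 := c - 1 / 2 - u0) in *.
  assert (Hx1 : 0 < x1) by (unfold x1; lra).
  assert (Hp1 : p1 n s a = (x1 + s) / x1).
  { unfold p1. rewrite Hd1. fold r. rewrite Har.
    replace (INR n + 2 * s - 2 + 4 * u0) with (4 * (x1 + s)) by (unfold x1, c; field).
    field. lra. }
  assert (Hp2 : 0 < x2 -> p2 n s a = (x2 + s) / x2).
  { intros H. unfold p2. rewrite Hd2. fold r. rewrite Har.
    replace (INR n + 2 * s - 2 - 4 * u0) with (4 * (x2 + s)) by (unfold x2, c; field).
    field. lra. }
  assert (Hroots : forall p, rootE n s p <->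
            p = p1 n s a \/ (0 < x2 /\ p = p2 n s a)).
  { intros p. rewrite (rootE_iff_param n s c p) by auto. split.
    - intros (x & Hx & -> & HE).
      apply Hu in HE; [|apply Rabs_def1; lra].
      unfold Rabs in HE; destruct (Rcase_abs (x - (c - 1 / 2))).
      + assert (x = x2) by (unfold x2; lra). subst x. right.
        split; [lra|rewrite Hp2; lra].
      + assert (x = x1) by (unfold x1; lra). subst x. left. lra.
    - intros [->|[Hx2 ->]].
      + exists x1. split; [unfold x1 in *; lra|split; [auto|]].
        apply Hu; replace (x1 - (c - 1 / 2)) with u0 by (unfold x1; ring);
          rewrite Rabs_pos_eq; lra.
      + exists x2. split; [unfold x2 in *; lra|split; [auto|]].
        apply Hu; replace (x2 - (c - 1 / 2)) with (- u0) by (unfold x2; ring);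
          rewrite Rabs_Ropp, Rabs_pos_eq; lra. }
  (* For [c > 1/2], the gap is negative iff [c - 1/2] lies beyond the level point [u0]. *)
  assert (HQx : Q n <-> 0 < x2).
  { unfold Q. fold c. rewrite <- sym_incr_endpoint.
    rewrite <- (proj2 (Hu u0 ltac:(rewrite Rabs_pos_eq; lra)) ltac:(rewrite Rabs_pos_eq; lra)).
    unfold x2. split.
    - intros [H1 H2]. apply Rnot_le_lt. intros Hle.
      destruct (Req_dec u0 (c - 1 / 2)) as [->|Hne]; [lra|].
      pose proof (sym_incr_strict_decr s (c + 1 / 2) u0 (c - 1 / 2)). lra.
    - intros H. split; [lra|].
      pose proof (sym_incr_strict_decr s (c + 1 / 2) (c - 1 / 2) u0). lra. }
  assert (Hscale : forall b y, b * r / 2 = y -> b = 2 * y / r).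
  { intros b y <-. field. lra. }
  assert (Hdom : 1 / 2 * ((INR n - 2 * s) / r) + 1 / r = 2 * (c + 1 / 2) / r).
  { unfold c. field. lra. }
  assert (Hmono : forall y z, y < z -> 2 * y / r < 2 * z / r).
  { intros y z Hyz. apply Rmult_lt_compat_r; [apply Rinv_0_lt_compat; auto|lra]. }
  exists a. split; [|split].
  - split.
    + split; [|split].
      * unfold f_dom. fold r.
        pose proof (Hmono u0 (c + 1 / 2) Hu2). pose proof (Hmono 0 u0 ltac:(lra)) as H0.
        replace (2 * 0 / r) with 0 in H0 by (field; lra). fold a in H, H0. lra.
      * apply Rdiv_lt_0_compat; lra.
      * rewrite f_eq_sym_incr. fold r c. replace (a * r / 2) with u0 by lra.
        apply Rminus_diag_eq, Hu; rewrite Rabs_pos_eq; lra.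
    + intros b ([Hb1 Hb2] & Hb0 & Hb). rewrite f_eq_sym_incr in Hb.
      fold r in Hb, Hb1, Hb2. fold c in Hb. rewrite Hdom in Hb2.
      apply Rminus_diag_uniq in Hb.
      assert (Hbr : 0 < b * r) by (apply Rmult_lt_0_compat; auto).
      assert (Hbd : b * r / 2 < c + 1 / 2).
      { apply Rmult_lt_compat_r with (r := r) in Hb2; [|auto].
        replace (2 * (c + 1 / 2) / r * r) with (2 * (c + 1 / 2)) in Hb2 by (field; lra). lra. }
      apply Hu in Hb; [|rewrite Rabs_pos_eq; lra].
      rewrite Rabs_pos_eq in Hb by lra. symmetry. apply Hscale, Hb.
  - intros Hle. apply HQ in Hle. rewrite HQx in Hle.
    fold r. rewrite Hdom.
    replace (1 / r) with (2 * (1 / 2) / r) by (field; lra).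
    split; [apply Hmono; auto|split; [apply Hmono; auto|split; [lra|]]].
    intros p. rewrite Hroots. tauto.
  - intros Hlt.
    assert (Hx2 : 0 < x2).
    { apply HQx. apply Classical_Prop.NNPP. intros H. apply HQ in H. lia. }
    assert (Hpar : forall x y, 0 < x -> x < y -> (y + s) / y < (x + s) / x).
    { intros x y Hx Hxy. replace ((y + s) / y) with (1 + s / y) by (field; lra).
      replace ((x + s) / x) with (1 + s / x) by (field; lra).
      apply Rplus_lt_compat_l, Rmult_lt_compat_l; [auto|].
      apply Rinv_lt_contravar; [nra|lra]. }
    replace (INR n / (INR n - 2 * s)) with ((2 * c + s) / (2 * c)) by (unfold c; field; lra).
    replace ((INR n + 2 * s) / (INR n - 2 * s)) with ((c + s) / c) by (unfold c; field; lra).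
    rewrite Hp1, Hp2 by auto. split; [lra|split; [lra|split; [|split; [|split; [|split]]]]].
    + intros p. rewrite Hroots, Hp1, Hp2 by auto. tauto.
    + apply Hpar; [auto|unfold x1; lra].
    + apply Hpar; [auto|unfold x1; lra].
    + apply Hpar; [auto|unfold x2; lra].
    + exact I.
Qed.
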